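(* (The Mixed Poncelet–Steiner Closure Theorem) Let $k$ and $\omega$ be two circles in the plane such that $\omega$ lies inside $k$. Let $\omega_1$ be any circle inscribed in the annulus between $k$ and $\omega$, and let $t_1$ be a common external tangent of $\omega_1$ and $\omega$. Define successively, for $i = 1, 2, 3, \ldots$: $\omega_{i+1}$ is the second circle (other than $\omega_i$) which is inscribed in the annulus between $k$ and $\omega$, is tangent to $t_i$, and lies on the same side of $t_i$ as $\omega$; and $t_{i+1}$ is the second common external tangent (other than $t_i$) of $\omega_{i+1}$ and $\omega$. Let $n$ be a positive integer. If $\omega_{n+1} = \omega_1$ for some choice of the initial circle $\omega_1$ and the initial tangent $t_1$, then $\omega_{n+1} = \omega_1$ for any choice of the initial circle $\omega_1$ and the initial tangent $t_1$.
   Context: A circle is inscribed in the annulus between $k$ and $\omega$ if it is tangent internally to $k$ and tangent externally to $\omega$. A common external tangent of two circles is a line tangent to both and having both on the same side. For each tangent line $t$ of $\omega$ there are exactly two circles inscribed in the annulus that are tangent to $t$ and lie on the same side of $t$ as $\omega$. *)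

(* Defs.v *)
From mathcomp Require Import all_boot all_order all_algebra.
From mathcomp Require Import all_classical reals.
Set Implicit Arguments.
Unset Strict Implicit.
Unset Printing Implicit Defensive.
Import Order.TTheory GRing.Theory Num.Theory.
Local Open Scope classical_set_scope.
Local Open Scope ring_scope.

(* The plane is R * R. The norm the libraries put on a product is the max
   norm, so the Euclidean distance is written out in coordinates. *)
Record circle (R : realType) := Circle {
  center : R * R;
  radius : R;
  radius_gt0 : 0 < radius
}.

Definition dist2 (R : realType) (p q : R * R) : R :=
  (p.1 - q.1) ^+ 2 + (p.2 - q.2) ^+ 2.

Definition points (R : realType) (c : circle R) : set (R * R) :=
  [set p | dist2 p (center c) = radius c ^+ 2].

Definition disc (R : realType) (c : circle R) : set (R * R) :=
  [set p | dist2 p (center c) < radius c ^+ 2].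

Definition lies_inside (R : realType) (c k : circle R) : Prop :=
  points c `<=` disc k.

Definition tangent_circles (R : realType) (c d : circle R) : Prop :=
  exists p, points c `&` points d = [set p].

Definition tangent_internally (R : realType) (c k : circle R) : Prop :=
  tangent_circles c k /\ points c `<=` disc k `|` points k.

(* Disjoint open discs: a circle surrounding d would also have its points
   outside d. *)
Definition tangent_externally (R : realType) (c d : circle R) : Prop :=
  tangent_circles c d /\ disc c `&` disc d = set0.

Definition inscribed (R : realType) (k w c : circle R) : Prop :=
  tangent_internally c k /\ tangent_externally c w.

(* Lines are point sets, so that equality of lines does not depend on the
   choice of an equation. *)
Definition line_eq (R : realType) (a b e : R) : set (R * R) :=
  [set p | a * p.1 + b * p.2 = e].

Definition is_line (R : realType) (l : set (R * R)) : Prop :=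
  exists a b e : R, (a, b) != (0, 0) /\ l = line_eq a b e.

Definition tangent_line (R : realType) (l : set (R * R)) (c : circle R) : Prop :=
  is_line l /\ exists p, l `&` points c = [set p].

(* Both circles lie in one closed half-plane bounded by l; the other
   half-plane is obtained by negating a, b and e. *)
Definition same_side (R : realType) (l : set (R * R)) (c d : circle R) : Prop :=
  exists a b e : R,
    [/\ (a, b) != (0, 0), l = line_eq a b e &
        points c `|` points d `<=` [set p | e <= a * p.1 + b * p.2]].

Definition common_external_tangent (R : realType) (l : set (R * R))
    (c d : circle R) : Prop :=
  [/\ tangent_line l c, tangent_line l d & same_side l c d].

(* Indices start at 1; the values c 0 and t 0 are irrelevant. *)
Definition mixed_chain (R : realType) (k w : circle R)
    (c : nat -> circle R) (t : nat -> set (R * R)) : Prop :=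
  [/\ inscribed k w (c 1%N),
      common_external_tangent (t 1%N) (c 1%N) w &
      forall i : nat, (1 <= i)%N ->
        [/\ inscribed k w (c i.+1), tangent_line (t i) (c i.+1),
            same_side (t i) (c i.+1) w & c i.+1 <> c i] /\
        (common_external_tangent (t i.+1) (c i.+1) w /\ t i.+1 <> t i)].

(* Main.v *)
Require Import Defs.
From mathcomp Require Import all_boot all_order all_algebra.
From mathcomp Require Import all_classical reals.
From mathcomp Require Import ring lra.
Import Order.TTheory GRing.Theory Num.Theory.
Local Open Scope classical_set_scope.
Local Open Scope ring_scope.

Set Implicit Arguments.
Unset Strict Implicit.
Unset Printing Implicit Defensive.

(* Record omega_i by the direction P_i of its contact point with omega, and t_i
   by the direction Q_i of its contact point with omega. With the first axis
   along the line of centres, omega_i and t_i (and likewise omega_(i+1) and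
   t_i) touch iff P.Q + B P.1 = a, where a and B depend only on k and omega.
   This equation defines an elliptic curve on which exchanging the two P over
   one Q, and the two Q over one P, are reflections, so the chain iterates a
   translation. For two chains run side by side, an odd elliptic function J of
   the difference of their states is therefore preserved by a full step (each
   reflection changes its sign). J is rational in (P, Q), and the verification
   is polynomial once J is also written in terms of the Q coordinates. The real
   curve has two components, told apart by the sign of the cross product of P
   and Q, which a full step preserves too. A state is determined by its
   component and by J relative to a given state, so if one chain returns to its
   initial state, so does the other. *)

(** * Incident pairs of directions *)

Definition unitv (R : realFieldType) (P : R * R) : Prop :=
  P.1 ^+ 2 + P.2 ^+ 2 = 1.

Definition cross (R : realFieldType) (P Q : R * R) : R :=
  P.1 * Q.2 - P.2 * Q.1.

Definition incident (R : realFieldType) (a B : R) (P Q : R * R) : Prop :=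
  [/\ unitv P, unitv Q & P.1 * Q.1 + P.2 * Q.2 + B * P.1 = a].

(** Amounts to [|a| + B < 1] with [B] nonnegative: the cosine [a - B * P.1] of the angle between
    incident directions stays strictly between -1 and 1. *)
Definition annular (R : realFieldType) (a B : R) : Prop :=
  [/\ 0 <= B, a + B < 1 & B - a < 1].

Lemma unitv_le1 (R : realFieldType) (P : R * R) :
  unitv P -> - 1 <= P.1 <= 1.
Proof. rewrite /unitv => h; apply/andP; split; nra. Qed.

Lemma annular_lt1 (R : realFieldType) (a B x : R) :
  annular a B -> - 1 <= x <= 1 -> 0 < 1 - (a - B * x) ^+ 2.
Proof.
case=> B0 h1 h2 /andP[x1 x2].
have -> : 1 - (a - B * x) ^+ 2 = (1 - (a - B * x)) * (1 + (a - B * x)) by ring.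
apply: mulr_gt0; nra.
Qed.

(** The expression is affine in [x], with values [1 - (a + B) ^+ 2] at -1 and [1 - (a - B) ^+ 2] at
    1. *)
Lemma annular_coef_gt0 (R : realFieldType) (a B x : R) :
  annular a B -> - 1 <= x <= 1 ->
  0 < 1 - a ^+ 2 - B ^+ 2 + 2 * a * B * x.
Proof.
case=> B0 h1 h2 /andP[x1 x2].
have i1 : 0 < (1 - (a + B)) * (1 + (a + B)) by apply: mulr_gt0; lra.
have i2 : 0 < (1 - (a - B)) * (1 + (a - B)) by apply: mulr_gt0; lra.
have j1 : 0 <= (1 - x) * ((1 - (a + B)) * (1 + (a + B))).
  by apply: mulr_ge0; [lra | exact: ltW].
have j2 : 0 <= (1 + x) * ((1 - (a - B)) * (1 + (a - B))).
  by apply: mulr_ge0; [lra | exact: ltW].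
have [x0|x0] := leP 0 x.
- have : 0 < (1 + x) * ((1 - (a - B)) * (1 + (a - B))).
    by apply: mulr_gt0; lra.
  lra.
- have : 0 < (1 - x) * ((1 - (a + B)) * (1 + (a + B))).
    by apply: mulr_gt0; lra.
  lra.
Qed.

(** [Q] is expanded in the orthonormal basis formed by [P] and its quarter turn; the last equation
    is Lagrange's identity. *)
Lemma incidentE (R : realFieldType) (a B : R) (P Q : R * R) :
  incident a B P Q ->
  [/\ Q.1 = (a - B * P.1) * P.1 - cross P Q * P.2,
      Q.2 = (a - B * P.1) * P.2 + cross P Q * P.1,
      P.2 ^+ 2 = 1 - P.1 ^+ 2 &
      cross P Q ^+ 2 = 1 - (a - B * P.1) ^+ 2].
Proof.
case: P Q => [p s] [q t] [] /=; rewrite /unitv /cross /= => hP hQ <-.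
have hs : s ^+ 2 = 1 - p ^+ 2 by lra.
have ht : t ^+ 2 = 1 - q ^+ 2 by lra.
by split=> //; ring: hs ht.
Qed.

Lemma cross_neq0 (R : realFieldType) (a B : R) (P Q : R * R) :
  annular a B -> incident a B P Q -> cross P Q != 0.
Proof.
move=> hab hPQ; have [_ _ _ hn] := incidentE hPQ; have [hP _ _] := hPQ.
by rewrite -sqrf_eq0 hn gt_eqF// annular_lt1// unitv_le1.
Qed.


(** * The value [J] as a projective relation *)

Definition coupled (R : realFieldType) (al be N W V N' : R) : Prop :=
  al * N = be * W /\ al * V = be * N'.

(** The equations make each row of the matrix [(X, Y; Z, X')] proportional to each row of
    [(N, W; V, N')]; a nonzero entry of the latter can be cancelled. *)
Lemma coupled_transfer (R : realFieldType) (al be N W V N' X Y Z X' : R) :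
  [\/ N != 0, W != 0, V != 0 | N' != 0] ->
  [/\ N * Y = W * X, N * X' = W * Z, V * Y = N' * X & V * X' = N' * Z] ->
  coupled al be N W V N' -> coupled al be X Y Z X'.
Proof.
move=> nz [e1 e2 e3 e4] [h1 h2].
have k1 x : x * (al * N) = x * (be * W) by rewrite h1.
have k2 x : x * (al * V) = x * (be * N') by rewrite h2.
case: nz => nz; split; apply: (mulfI nz).
- by move: (k1 X) (congr1 ( *%R be) e1); lra.
- by move: (k1 Z) (congr1 ( *%R be) e2); lra.
- by move: (k1 Y) (congr1 ( *%R al) e1); lra.
- by move: (k1 X') (congr1 ( *%R al) e2); lra.
- by move: (k2 X) (congr1 ( *%R be) e3); lra.
- by move: (k2 Z) (congr1 ( *%R be) e4); lra.
- by move: (k2 Y) (congr1 ( *%R al) e3); lra.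
- by move: (k2 X') (congr1 ( *%R al) e4); lra.
Qed.

(* With n = cross P Q, the invariant of a pair of chains is
   J = (P.2 n' + P'.2 n) / (P.1 - P'.1) = V / (P.2 n' - P'.2 n).
   Either quotient may be 0/0, but never both, so J is handled as the kernel
   line (al, be) of the rank one matrix made of both. *)
Definition pcoupled (R : realFieldType) (a B al be : R) (P Q P' Q' : R * R) :=
  let n := cross P Q in let n' := cross P' Q' in
  coupled al be (P.2 * n' + P'.2 * n) (P.1 - P'.1)
    (a * (P.1 * (a - B * P'.1) + P'.1 * (a - B * P.1)) - (P.1 + P'.1)
      - B * ((a - B * P.1) + (a - B * P'.1)))
    (P.2 * n' - P'.2 * n).

(* The same value J, written with the coordinates of Q *)
Definition qcoupled (R : realFieldType) (a B al be : R) (P Q P' Q' : R * R) :=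
  let mu := cross P Q - B * P.2 in let mu' := cross P' Q' - B * P'.2 in
  coupled al be (Q.2 * mu' + Q'.2 * mu) (Q.1 - Q'.1)
    (- ((1 + B ^+ 2 - a ^+ 2) * (Q.1 + Q'.1) + 2 * B + 2 * B * (Q.1 * Q'.1)))
    (Q.2 * mu' - Q'.2 * mu).

(** Lagrange's identity for [P] and [Q + (B, 0)], whose dot product is [a]. The square thus depends
    on [Q] only. *)
Lemma incident_mu (R : realFieldType) (a B : R) (P Q : R * R) :
  incident a B P Q ->
  (cross P Q - B * P.2) ^+ 2 = 1 + B ^+ 2 - a ^+ 2 + 2 * B * Q.1.
Proof.
case: P Q => [p s] [q t] [] /=; rewrite /unitv /cross /= => hP hQ <-.
have hs : s ^+ 2 = 1 - p ^+ 2 by lra.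
have ht : t ^+ 2 = 1 - q ^+ 2 by lra.
ring: hs ht.
Qed.

Lemma incident_mu_neq0 (R : realFieldType) (a B : R) (P Q : R * R) :
  annular a B -> incident a B P Q -> cross P Q - B * P.2 != 0.
Proof.
move=> [B0 h1 h2] hPQ; rewrite -sqrf_eq0 (incident_mu hPQ) gt_eqF//.
have [_ /unitv_le1/andP[q1 q2] _] := hPQ.
have i1 : 0 < (1 - B - a) * (1 - B + a) by apply: mulr_gt0; lra.
nra.
Qed.

(** If both entries containing [s] vanish, so does their sum [2 * s * n'], whence [s = 0]; the last
    hypothesis covers what remains. *)
Lemma coupling_matrix_neq0 (R : realFieldType) (p s n p' s' n' V : R) :
  s ^+ 2 = 1 - p ^+ 2 -> n != 0 -> n' != 0 ->
  (p = p' -> s = 0 -> V != 0) ->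
  [\/ s * n' + s' * n != 0, p - p' != 0, V != 0 | s * n' - s' * n != 0].
Proof.
move=> hs n0 n0' hV.
have [e1|] := eqVneq (s * n' + s' * n) 0; last by constructor 1.
have [e2|] := eqVneq (p - p') 0; last by constructor 2.
have [e4|] := eqVneq (s * n' - s' * n) 0; last by constructor 4.
constructor 3; apply: hV; first by apply/eqP; rewrite -subr_eq0 e2.
apply: (mulIf n0'); lra.
Qed.

(** The matrices for [J] in [P] and in [Q] coordinates have proportional rows. Once [incidentE]
    eliminates [Q] and [Q'], these are polynomial identities modulo the quadratic relations for
    [P.2], [P'.2], [n] and [n']. *)
Lemma coupled_equations (R : realFieldType) (a B : R) (P Q P' Q' : R * R) :
  let n := cross P Q in let n' := cross P' Q' in
  let mu := n - B * P.2 in let mu' := n' - B * P'.2 in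
  let N := P.2 * n' + P'.2 * n in let N' := P.2 * n' - P'.2 * n in
  let W := P.1 - P'.1 in
  let V := a * (P.1 * (a - B * P'.1) + P'.1 * (a - B * P.1)) - (P.1 + P'.1)
      - B * ((a - B * P.1) + (a - B * P'.1)) in
  let X := Q.2 * mu' + Q'.2 * mu in let X' := Q.2 * mu' - Q'.2 * mu in
  let Y := Q.1 - Q'.1 in
  let Z := - ((1 + B ^+ 2 - a ^+ 2) * (Q.1 + Q'.1) + 2 * B
                + 2 * B * (Q.1 * Q'.1)) in
  incident a B P Q -> incident a B P' Q' ->
  [/\ N * Y = W * X, N * X' = W * Z, V * Y = N' * X & V * X' = N' * Z].
Proof.
move=> n n' mu mu' N N' W V X X' Y Z /incidentE[e1 e2 hs hn].
move=> /incidentE[e1' e2' hs' hn'].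
rewrite -/n in e1 e2 hn; rewrite -/n' in e1' e2' hn'.
rewrite /X /X' /Y /Z e1 e2 e1' e2' /N /N' /W /V /mu /mu'.
move: n n' {mu mu' N N' W V X X' Y Z e1 e2 e1' e2'} hn hn' hs hs'.
move: P.1 P.2 P'.1 P'.2 => p s p' s' n n' hn hn' hs hs'.
split; ring: hs hs' hn hn'.
Qed.

(** * The coupling of two chains *)

Lemma pmatrix_neq0 (R : realFieldType) (a B : R) (P Q P' Q' : R * R) :
  let n := cross P Q in let n' := cross P' Q' in
  annular a B -> incident a B P Q -> incident a B P' Q' ->
  [\/ P.2 * n' + P'.2 * n != 0, P.1 - P'.1 != 0,
      a * (P.1 * (a - B * P'.1) + P'.1 * (a - B * P.1)) - (P.1 + P'.1)
        - B * ((a - B * P.1) + (a - B * P'.1)) != 0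
    | P.2 * n' - P'.2 * n != 0].
Proof.
move=> n n' hab i i'; have [_ _ hs _] := incidentE i.
apply: coupling_matrix_neq0 => //; [exact: cross_neq0 i | exact: cross_neq0 i' |].
move=> <- s0; have hp : P.1 ^+ 2 = 1 by move: hs; rewrite s0; lra.
have hP : unitv P by case: i.
have g0 := annular_lt1 hab (unitv_le1 hP).
have p0 : P.1 != 0 by rewrite -sqrf_eq0 hp oner_eq0.
set V := (X in X != 0).
have -> : V = - 2 * P.1 * (1 - (a - B * P.1) ^+ 2) by rewrite /V; ring: hp.
by rewrite !mulf_neq0// ?oppr_eq0 ?pnatr_eq0// gt_eqF.
Qed.

Lemma pcoupled_qcoupled (R : realFieldType) (a B al be : R) (P Q P' Q' : R * R) :
  annular a B -> incident a B P Q -> incident a B P' Q' ->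
  pcoupled a B al be P Q P' Q' -> qcoupled a B al be P Q P' Q'.
Proof.
move=> hab i i'; apply: coupled_transfer; last exact: coupled_equations.
exact: pmatrix_neq0.
Qed.

Lemma qcoupled_pcoupled (R : realFieldType) (a B al be : R) (P Q P' Q' : R * R) :
  annular a B -> incident a B P Q -> incident a B P' Q' ->
  qcoupled a B al be P Q P' Q' -> pcoupled a B al be P Q P' Q'.
Proof.
move=> hab i i'.
have [e1 e2 e3 e4] := coupled_equations i i'.
apply: coupled_transfer; last first.
  by split; rewrite [LHS]mulrC [RHS]mulrC.
have hQ : unitv Q by case: i.
have hs : Q.2 ^+ 2 = 1 - Q.1 ^+ 2 by rewrite -hQ; ring.
have mu0 := incident_mu_neq0 hab i.
apply: coupling_matrix_neq0 => //; first exact: incident_mu_neq0 hab i'.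
move=> <- s0; have hp : Q.1 ^+ 2 = 1 by move: hs; rewrite s0; lra.
have p0 : Q.1 != 0 by rewrite -sqrf_eq0 hp oner_eq0.
set V := (X in X != 0).
have -> : V = - 2 * Q.1 * (cross P Q - B * P.2) ^+ 2.
  by rewrite (incident_mu i) /V; ring: hp.
by rewrite !mulf_neq0// ?oppr_eq0 ?pnatr_eq0// gt_eqF.
Qed.

(** * Sign changes under the two reflections *)

Lemma pcoupled_flip (R : realFieldType) (a B al be : R)
    (P P' Q1 Q2 Q1' Q2' : R * R) :
  cross P Q2 = - cross P Q1 -> cross P' Q2' = - cross P' Q1' ->
  pcoupled a B al be P Q1 P' Q1' -> pcoupled a B (- al) be P Q2 P' Q2'.
Proof. by rewrite /pcoupled => -> -> [h1 h2]; split; lra. Qed.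

Lemma qcoupled_flip (R : realFieldType) (a B al be : R)
    (P1 P2 P1' P2' Q Q' : R * R) :
  cross P2 Q - B * P2.2 = - (cross P1 Q - B * P1.2) ->
  cross P2' Q' - B * P2'.2 = - (cross P1' Q' - B * P1'.2) ->
  qcoupled a B al be P1 Q P1' Q' -> qcoupled a B (- al) be P2 Q P2' Q'.
Proof. by rewrite /qcoupled => -> -> [h1 h2]; split; lra. Qed.

(** The square of the cross product depends on [P] alone, and [Q] is recovered from [P] and the
    cross product, so distinct [Q] differ in its sign. *)
Lemma cross_second (R : realFieldType) (a B : R) (P Q1 Q2 : R * R) :
  incident a B P Q1 -> incident a B P Q2 -> Q2 <> Q1 ->
  cross P Q2 = - cross P Q1.
Proof.
move=> /incidentE[e1 e2 _ h1] /incidentE[f1 f2 _ h2] ne.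
have /eqP : cross P Q2 ^+ 2 = cross P Q1 ^+ 2 by rewrite h1 h2.
rewrite eqf_sqr => /orP[/eqP e|/eqP //]; case: ne.
by rewrite [Q1]surjective_pairing [Q2]surjective_pairing e1 e2 f1 f2 e.
Qed.

(* With N = Q + (B, 0), one has N.P = a and cross P N = mu. *)
Lemma incident_inv (R : realFieldType) (a B : R) (P Q : R * R) :
  incident a B P Q ->
  let n2 := 1 + B ^+ 2 + 2 * B * Q.1 in let mu := cross P Q - B * P.2 in
  n2 * P.1 = a * (Q.1 + B) + mu * Q.2 /\ n2 * P.2 = a * Q.2 - mu * (Q.1 + B).
Proof.
case: P Q => [p s] [q t] [] /=; rewrite /unitv /cross /= => hP hQ <-.
have ht : t ^+ 2 = 1 - q ^+ 2 by lra.
by split; ring: ht.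
Qed.

Lemma incident_n2_gt0 (R : realFieldType) (a B : R) (P Q : R * R) :
  annular a B -> incident a B P Q -> 0 < 1 + B ^+ 2 + 2 * B * Q.1.
Proof.
move=> hab i.
have h : 0 < (cross P Q - B * P.2) ^+ 2.
  by rewrite exprn_even_gt0//= (incident_mu_neq0 hab i).
by move: h; rewrite (incident_mu i); have := sqr_ge0 a; lra.
Qed.

Lemma mu_second (R : realFieldType) (a B : R) (P1 P2 Q : R * R) :
  annular a B -> incident a B P1 Q -> incident a B P2 Q -> P2 <> P1 ->
  cross P2 Q - B * P2.2 = - (cross P1 Q - B * P1.2).
Proof.
move=> hab i1 i2 ne.
have n0 := incident_n2_gt0 hab i1.
have [e1 e2] := incident_inv i1; have [f1 f2] := incident_inv i2.
have /eqP : (cross P2 Q - B * P2.2) ^+ 2 = (cross P1 Q - B * P1.2) ^+ 2.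
  by rewrite (incident_mu i1) (incident_mu i2).
rewrite eqf_sqr => /orP[/eqP e|/eqP //]; case: ne.
rewrite [P1]surjective_pairing [P2]surjective_pairing.
by congr (_, _); apply: (mulfI (lt0r_neq0 n0)); rewrite ?e1 ?e2 ?f1 ?f2 e.
Qed.

(* The line P1 P2 = {x | x.N = a} meets the line OQ inside the unit circle,
   so it separates P1 from P2. *)
Lemma cross_second_lt0 (R : realFieldType) (a B : R) (P1 P2 Q : R * R) :
  annular a B -> incident a B P1 Q -> incident a B P2 Q -> P2 <> P1 ->
  cross P1 Q * cross P2 Q < 0.
Proof.
move=> hab i1 i2 ne; have m2 := mu_second hab i1 i2 ne.
have n0 := incident_n2_gt0 hab i1.
have [e1 e2] := incident_inv i1; have [f1 f2] := incident_inv i2.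
have hQ : unitv Q by case: i1.
have [q1 q2] := andP (unitv_le1 hQ).
have hs : Q.2 ^+ 2 = 1 - Q.1 ^+ 2 by rewrite -hQ; ring.
have hm := incident_mu i1; set mu := cross P1 Q - B * P1.2 in m2 e1 e2 hm.
rewrite m2 in f1 f2.
set n2 := 1 + B ^+ 2 + _ in n0 e1 e2 f1 f2.
suff: n2 ^+ 2 * (cross P1 Q * cross P2 Q) < 0.
  by rewrite pmulr_rlt0 // exprn_gt0.
have -> : n2 ^+ 2 * (cross P1 Q * cross P2 Q)
  = (n2 * P1.1 * Q.2 - n2 * P1.2 * Q.1) * (n2 * P2.1 * Q.2 - n2 * P2.2 * Q.1).
  by rewrite /cross; ring.
rewrite e1 e2 f1 f2.
set L := (X in X < 0).
have -> : L = - (n2 * ((1 + B * Q.1 - a) * (1 + B * Q.1 + a))).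
  by rewrite /L /n2; ring: hs hm.
case: hab => B0 h1 h2.
rewrite oppr_lt0; apply: mulr_gt0 => //; apply: mulr_gt0; nra.
Qed.

(** The matrix is nonzero with determinant zero ([det]), so a nonzero row, with its entries swapped,
    spans the kernel. *)
Lemma pcoupled_ex (R : realFieldType) (a B : R) (P Q P' Q' : R * R) :
  annular a B -> incident a B P Q -> incident a B P' Q' ->
  exists al be : R, ((al != 0) || (be != 0)) /\ pcoupled a B al be P Q P' Q'.
Proof.
move=> hab i i'; rewrite /pcoupled /=.
have nz := pmatrix_neq0 hab i i'.
set N := P.2 * _ + _ in nz *; set N' := P.2 * _ - _ in nz *.
set W := P.1 - _ in nz *; set V := _ - _ - _ in nz *.
have det : N * N' = W * V.
  have [_ _ hs hn] := incidentE i; have [_ _ hs' hn'] := incidentE i'.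
  by rewrite /N /N' /W /V; ring: hs hs' hn hn'.
have k1 : (W != 0) || (N != 0) ->
    exists al be : R, ((al != 0) || (be != 0)) /\ coupled al be N W V N'.
  by move=> h; exists W, N; split=> //; split; [rewrite mulrC | rewrite det].
have k2 : (N' != 0) || (V != 0) ->
    exists al be : R, ((al != 0) || (be != 0)) /\ coupled al be N W V N'.
  by move=> h; exists N', V; split=> //; split; [rewrite mulrC det mulrC | rewrite mulrC].
by case: nz => h; [apply: k1 | apply: k1 | apply: k2 | apply: k2]; rewrite h ?orbT.
Qed.

Lemma pcoupled_step (R : realFieldType) (a B al be : R)
    (P1 Q1 P2 Q2 P1' Q1' P2' Q2' : R * R) :
  annular a B ->
  incident a B P1 Q1 -> incident a B P2 Q1 -> incident a B P2 Q2 ->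
  P2 <> P1 -> Q2 <> Q1 ->
  incident a B P1' Q1' -> incident a B P2' Q1' -> incident a B P2' Q2' ->
  P2' <> P1' -> Q2' <> Q1' ->
  pcoupled a B al be P1 Q1 P1' Q1' -> pcoupled a B al be P2 Q2 P2' Q2'.
Proof.
move=> hab i11 i21 i22 nP nQ i11' i21' i22' nP' nQ' h.
(* Two sign changes cancel: [P1] to [P2] over [Q1], seen in [qcoupled], and [Q1] to [Q2] over [P2],
   seen in [pcoupled]. *)
rewrite -[al]opprK.
apply: (pcoupled_flip (cross_second i21 i22 nQ) (cross_second i21' i22' nQ')).
apply: qcoupled_pcoupled => //.
apply: (qcoupled_flip (mu_second hab i11 i21 nP) (mu_second hab i11' i21' nP')).
exact: pcoupled_qcoupled.
Qed.

Lemma cross_step_gt0 (R : realFieldType) (a B : R) (P1 Q1 P2 Q2 : R * R) :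
  annular a B ->
  incident a B P1 Q1 -> incident a B P2 Q1 -> incident a B P2 Q2 ->
  P2 <> P1 -> Q2 <> Q1 -> 0 < cross P1 Q1 * cross P2 Q2.
Proof.
move=> hab i11 i21 i22 nP nQ.
rewrite (cross_second i21 i22 nQ) mulrN oppr_gt0.
exact: (cross_second_lt0 hab).
Qed.

(* x and y are zeros of a downward parabola that is positive at x0, so they
   would lie on opposite sides of x0 if they were distinct. *)
Lemma roots_separated (R : realFieldType) (k a B D x0 x y : R) :
  0 < k -> 0 < 1 - (a - B * x0) ^+ 2 ->
  k * (1 - (a - B * x) ^+ 2) = D ^+ 2 * (x0 - x) ^+ 2 ->
  k * (1 - (a - B * y) ^+ 2) = D ^+ 2 * (x0 - y) ^+ 2 ->
  0 <= (x0 - x) * (x0 - y) -> x = y.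
Proof.
move=> k0 g0 hx hy hxy; apply/eqP; apply/negPn/negP => ne.
have d0 : x - y != 0 by rewrite subr_eq0.
have : (x - y) * (k * (1 - (a - B * x0) ^+ 2)
          + (k * B ^+ 2 + D ^+ 2) * ((x0 - x) * (x0 - y))) = 0.
  (* This combination of the two root equations is divisible by [x - y], and its cofactor is
     positive. *)
  transitivity ((x - x0) * (k * (1 - (a - B * y) ^+ 2) - D ^+ 2 * (x0 - y) ^+ 2)
    - (y - x0) * (k * (1 - (a - B * x) ^+ 2) - D ^+ 2 * (x0 - x) ^+ 2)).
    by ring.
  by rewrite hx hy !subrr !mulr0 subrr.
move/eqP; rewrite mulf_eq0 (negPf d0) /= gt_eqF//.
apply: ltr_pwDl; first exact: mulr_gt0.
by apply: mulr_ge0 => //; rewrite addr_ge0 ?sqr_ge0// mulr_ge0 ?sqr_ge0 ?ltW.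
Qed.

(** Adding [be] times the first coupling equation to [al] times the second eliminates the unknown
    second coordinate (see [eM]). The sign of the cross product then fixes the side of [x0] on which
    the first coordinate lies, and [roots_separated] leaves one candidate. *)
Lemma pcoupled_inj (R : realFieldType) (a B al be : R)
    (P Q P1 Q1 P2 Q2 : R * R) :
  annular a B -> (al != 0) || (be != 0) ->
  incident a B P Q -> incident a B P1 Q1 -> incident a B P2 Q2 ->
  pcoupled a B al be P Q P1 Q1 -> pcoupled a B al be P Q P2 Q2 ->
  0 < cross P1 Q1 * cross P2 Q2 -> P1 = P2.
Proof.
move=> hab nz i i1 i2.
have n0 := cross_neq0 hab i.
have [_ _ hs hn] := incidentE i.
have [_ _ hs1 hn1] := incidentE i1.
have [_ _ hs2 hn2] := incidentE i2.
have /unitv_le1 pb : unitv P by case: i.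
rewrite /pcoupled /coupled; move: (cross P Q) n0 hn => n n0 hn.
move: (cross P1 Q1) (cross P2 Q2) hn1 hn2 => n1 n2 hn1 hn2.
case: P P1 P2 hs hs1 hs2 pb hn hn1 hn2 {i i1 i2} => [p s] [p1 s1] [p2 s2] /=.
move=> hs hs1 hs2 pb hn hn1 hn2 [h1 k1] [h2 k2] sgn.
(* The third matrix entry is [e - c * p'] as a function of the unknown [p']; hence [x0] below is the
   mean of [p] and [e / c] with weights [be ^+ 2] and [al ^+ 2 * c]. *)
pose c := 1 - a ^+ 2 - B ^+ 2 + 2 * a * B * p.
pose e := - (p * (1 - a ^+ 2 - B ^+ 2) + 2 * a * B).
have c0 : 0 < c by exact: annular_coef_gt0.
pose D := be ^+ 2 + al ^+ 2 * c.
have D0 : 0 < D.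
  have [be0|be0] := eqVneq be 0.
    rewrite be0 eqxx orbF in nz.
    by rewrite /D be0 expr0n add0r mulr_gt0// exprn_even_gt0.
  rewrite ltr_pwDl// ?exprn_even_gt0//.
  by rewrite mulr_ge0 ?sqr_ge0// ltW.
pose x0 := (be ^+ 2 * p + al ^+ 2 * e) / D.
have hx0 : x0 * D = be ^+ 2 * p + al ^+ 2 * e by rewrite divfK// gt_eqF.
have eM (p' n' s' : R) : al * (s * n' + s' * n) = be * (p - p') ->
    al * (a * (p * (a - B * p') + p' * (a - B * p)) - (p + p')
      - B * (a - B * p + (a - B * p'))) = be * (s * n' - s' * n) ->
    2 * al * be * s * n' = D * (x0 - p').
  move=> h k; rewrite mulrBr [D * x0]mulrC hx0.
  move: (congr1 ( *%R be) h) (congr1 ( *%R al) k); rewrite /D /e /c; lra.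
have m1 := eM _ _ _ h1 k1; have m2 := eM _ _ _ h2 k2.
have x0b : - 1 <= x0 <= 1.
  have [b1 b2] := andP pb; case: hab => B0 ab1 ab2.
  have ec : 0 <= c - e.
    have -> : c - e = (1 + p) * ((1 - a + B) * (1 + a - B)) by rewrite /c /e; ring.
    by rewrite !mulr_ge0 //; lra.
  have ec' : 0 <= c + e.
    have -> : c + e = (1 - p) * ((1 - a - B) * (1 + a + B)) by rewrite /c /e; ring.
    by rewrite !mulr_ge0 //; lra.
  have a2 := sqr_ge0 al; have b2' := sqr_ge0 be.
  have := mulr_ge0 a2 ec; have := mulr_ge0 a2 ec'.
  have : 0 <= be ^+ 2 * (1 - p) by rewrite mulr_ge0// subr_ge0.
  have : 0 <= be ^+ 2 * (1 + p) by rewrite mulr_ge0//; lra.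
  by move=> *; apply/andP; split; rewrite -(ler_pM2r D0) hx0 /D; lra.
have e12 : p1 = p2.
  have [z|z] := eqVneq (2 * al * be * s) 0.
    have u (x : R) : 0 = D * (x0 - x) -> x = x0.
      move/esym/eqP; rewrite mulf_eq0 gt_eqF//= subr_eq0 => /eqP -> //.
    rewrite z !mul0r in m1 m2.
    by rewrite (u _ m1) (u _ m2).
  have zz : 0 < (2 * al * be * s) ^+ 2 by rewrite exprn_even_gt0.
  apply: (@roots_separated _ ((2 * al * be * s) ^+ 2) a B D x0) => //.
  - exact: annular_lt1.
  - by rewrite -hn1 -!exprMn m1.
  - by rewrite -hn2 -!exprMn m2.
  rewrite -(pmulr_rge0 _ (exprn_gt0 2 D0)).
  have -> : D ^+ 2 * ((x0 - p1) * (x0 - p2)) = (D * (x0 - p1)) * (D * (x0 - p2)) by ring.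
  rewrite -m1 -m2.
  have -> : 2 * al * be * s * n1 * (2 * al * be * s * n2)
    = (2 * al * be * s) ^+ 2 * (n1 * n2) by ring.
  by rewrite ltW// mulr_gt0.
have en : n1 = n2.
  have /eqP : n1 ^+ 2 = n2 ^+ 2 by rewrite hn1 hn2 e12.
  rewrite eqf_sqr => /orP[/eqP //|/eqP e0]; move: sgn; rewrite e0.
  by rewrite mulNr oppr_gt0 -expr2 ltNge sqr_ge0.
(* Subtracting the couplings leaves [al * n * (s1 - s2) = 0] and [be * n * (s1 - s2) = 0]. *)
rewrite -e12; congr (_, _); rewrite -e12 -en in h2 k2.
apply: (mulIf n0); case/orP: nz => nz0; apply: (mulfI nz0); lra.
Qed.

(** * Chains of directions and their closure *)

Definition chain (R : realFieldType) (a B : R) (P Q : nat -> R * R) : Prop :=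
  forall i, [/\ incident a B (P i) (Q i), incident a B (P i.+1) (Q i),
                P i.+1 <> P i & Q i.+1 <> Q i].

Lemma chain_cross_gt0 (R : realFieldType) (a B : R) (P Q : nat -> R * R) n :
  annular a B -> chain a B P Q -> 0 < cross (P 0) (Q 0) * cross (P n) (Q n).
Proof.
move=> hab ch; elim: n => [|n IH].
  by have [i _ _ _] := ch 0; rewrite -expr2 exprn_even_gt0//= (cross_neq0 hab i).
have [i1 i2 nP nQ] := ch n; have [i3 _ _ _] := ch n.+1.
have := mulr_gt0 IH (cross_step_gt0 hab i1 i2 i3 nP nQ).
have -> : forall x y z : R, x * y * (y * z) = y ^+ 2 * (x * z) by move=> *; ring.
by rewrite pmulr_rgt0 // exprn_even_gt0//= (cross_neq0 hab i1).
Qed.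

Lemma chain_closure (R : realFieldType) (a B : R) (P Q P' Q' : nat -> R * R) n :
  annular a B -> chain a B P Q -> chain a B P' Q' ->
  P n = P 0 -> P' n = P' 0.
Proof.
move=> hab ch ch' e.
have [i0 _ _ _] := ch 0; have [i0' _ _ _] := ch' 0.
have [in_ _ _ _] := ch n; have [in' _ _ _] := ch' n.
(* Otherwise [Q n] is the second direction over [P 0], and the cross product has changed sign. *)
have eQ : Q n = Q 0.
  have := chain_cross_gt0 n hab ch.
  have [//|ne] := pselect (Q n = Q 0).
  rewrite e in in_ *.
  by rewrite (cross_second i0 in_ ne) mulrN oppr_gt0 -expr2 ltNge sqr_ge0.
have [al [be [nz c0]]] := pcoupled_ex hab i0 i0'.
have cn m : pcoupled a B al be (P m) (Q m) (P' m) (Q' m).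
  elim: m => // m IH.
  have [a1 a2 a3 a4] := ch m; have [b1 _ _ _] := ch m.+1.
  have [a1' a2' a3' a4'] := ch' m; have [b1' _ _ _] := ch' m.+1.
  exact: (pcoupled_step hab a1 a2 b1 a3 a4 a1' a2' b1' a3' a4').
(* [P' 0] and [P' n] now have the same [J] relative to the single state [(P 0, Q 0)]. *)
have := cn n; rewrite e eQ => c1.
apply/esym; apply: (pcoupled_inj hab nz i0 i0' in' c0 c1).
exact: (chain_cross_gt0 n hab ch').
Qed.

(** * Tangency in coordinates *)

Lemma circle_eq (R : realType) (c d : circle R) :
  center c = center d -> radius c = radius d -> c = d.
Proof.
case: c d => [x r hr] [y r' hr'] /= -> e.
by move: hr; rewrite e => hr; congr Circle; exact: bool_irrelevance.
Qed.

(** The only common point is fixed by reflection in the line of centres. [u] points to it from the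
    centre of [d], and [t] is the signed position of the centre of [c] along [u]. *)
Lemma tangent_circles_axis (R : realType) (c d : circle R) :
  tangent_circles c d ->
  exists u t, [/\ unitv u,
    center c = ((center d).1 + t * u.1, (center d).2 + t * u.2) &
    t = radius d - radius c \/ t = radius d + radius c].
Proof.
case: c d => [[c1 c2] rho rho0] [[d1 d2] r r0] [[x y]].
rewrite /points /dist2 /= => hp.
have [/= hc hd] : (points (Circle (c1, c2) rho0) `&` points (Circle (d1, d2) r0)) (x, y).
  by rewrite /points /dist2 hp.
rewrite /points /dist2 /= in hc hd.
pose v := (x - d1, y - d2); pose w := (c1 - d1, c2 - d2).
(* The common point is its own mirror image in the line of centres. *)
have hx : v.1 * w.2 = v.2 * w.1.
  have [w0|w0] := eqVneq (w.1 ^+ 2 + w.2 ^+ 2) 0.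
    move/eqP: w0; rewrite paddr_eq0 ?sqr_ge0// !sqrf_eq0 => /andP[/eqP-> /eqP->].
    by rewrite !mulr0.
  pose k := (v.1 * w.1 + v.2 * w.2) / (w.1 ^+ 2 + w.2 ^+ 2).
  have hk : k * (w.1 ^+ 2 + w.2 ^+ 2) = v.1 * w.1 + v.2 * w.2 by rewrite divfK.
  have kk := congr1 ( *%R k) hk.
  have : [set (x, y)] (d1 + 2 * k * w.1 - v.1, d2 + 2 * k * w.2 - v.2).
    rewrite -hp; split=> /=; move: hc hd hk kk; rewrite /v /w /=; lra.
  move=> [e1 e2].
  clearbody k;   have f1 : v.1 = k * w.1 by rewrite /v /w /=; lra.
  have f2 : v.2 = k * w.2 by rewrite /v /w /=; lra.
  by rewrite f1 f2; ring.
have r00 : r != 0 by rewrite gt_eqF.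
have hv : v.1 ^+ 2 + v.2 ^+ 2 = r ^+ 2 by rewrite /v /=.
pose t := (v.1 * w.1 + v.2 * w.2) / r.
have tr : t * r = v.1 * w.1 + v.2 * w.2 by rewrite divfK.
have ev1 : w.1 = t * (v.1 / r).
  apply: (mulIf (expf_neq0 2 r00)).
  transitivity (t * r * v.1); last by rewrite expr2; field.
  by rewrite tr -hv; move: (congr1 ( *%R v.2) hx); lra.
have ev2 : w.2 = t * (v.2 / r).
  apply: (mulIf (expf_neq0 2 r00)).
  transitivity (t * r * v.2); last by rewrite expr2; field.
  by rewrite tr -hv; move: (congr1 ( *%R v.1) hx); lra.
exists (v.1 / r, v.2 / r), t; split.
- rewrite /unitv /= !exprMn -mulrDl hv exprVn divff//.
  by rewrite expf_neq0.
- by rewrite /= -ev1 -ev2 /w /=; congr (_, _); ring.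
have : rho ^+ 2 = (r - t) ^+ 2.
  have hw : w.1 ^+ 2 + w.2 ^+ 2 = t ^+ 2.
    have -> : w.1 ^+ 2 + w.2 ^+ 2 = t ^+ 2 * ((v.1 ^+ 2 + v.2 ^+ 2) / r ^+ 2).
      by rewrite {1}ev1 {1}ev2; field.
    by rewrite hv divff ?mulr1// expf_neq0.
  rewrite -hc; move: hw tr hv; rewrite /w /v /=; lra.
move/eqP; rewrite eqf_sqr => /orP[] /eqP; [left|right]; lra.
Qed.

Lemma tangent_externally_axis (R : realType) (c w : circle R) :
  tangent_externally c w ->
  exists2 P, unitv P &
    center c = ((center w).1 + (radius w + radius c) * P.1,
                (center w).2 + (radius w + radius c) * P.2).
Proof.
move=> [/tangent_circles_axis[u [t [hu hc [] ht]]] hdisj]; last first.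
  by exists u; rewrite // -ht.
exfalso.
case: c w hdisj hc ht => [[c1 c2] rho rho0] [[d1 d2] r r0] /= hdisj [hc1 hc2] ht.
(* In the nested position the centre of the smaller circle lies in both open discs. *)
pose s := if r <= rho then 0 else t.
have hs : s ^+ 2 < r ^+ 2 /\ (s - t) ^+ 2 < rho ^+ 2.
  have r2 := mulr_gt0 r0 r0; have rho2 := mulr_gt0 rho0 rho0.
  rewrite /s ht; case: (leP r rho) => h; split; try lra.
  - have : 0 < r * (2 * rho - r) by apply: mulr_gt0; lra.
    lra.
  - have : 0 < rho * (2 * r - rho) by apply: mulr_gt0; lra.
    lra.
have : set0 (d1 + s * u.1, d2 + s * u.2).
  rewrite -hdisj /disc /dist2 /= hc1 hc2; move: hs hu; rewrite /unitv.
  move: u s {hc1 hc2} => [u1 u2] s /= [h1 h2] hu.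
  split.
    have -> : (d1 + s * u1 - (d1 + t * u1)) ^+ 2 + (d2 + s * u2 - (d2 + t * u2)) ^+ 2
      = (s - t) ^+ 2 * (u1 ^+ 2 + u2 ^+ 2) by ring.
    by rewrite hu mulr1.
  have -> : (d1 + s * u1 - d1) ^+ 2 + (d2 + s * u2 - d2) ^+ 2
    = s ^+ 2 * (u1 ^+ 2 + u2 ^+ 2) by ring.
  by rewrite hu mulr1.
by [].
Qed.

Lemma tangent_internally_dist (R : realType) (c k : circle R) :
  tangent_internally c k ->
  dist2 (center c) (center k) = (radius k - radius c) ^+ 2.
Proof.
move=> [/tangent_circles_axis[u [t [hu hc ht]]] hsub].
case: c k hsub hc ht => [[c1 c2] rho rho0] [[d1 d2] r r0] /= hsub [hc1 hc2].
rewrite /dist2 /= hc1 hc2; move: u hu hc1 hc2 => [u1 u2]; rewrite /unitv /= => hu hc1 hc2.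
case=> ht.
  by rewrite -[LHS]mulr1 -[RHS]mulr1 -{2}hu -ht; ring: hu.
(* The far point of [c] would be at distance [r + 2 * rho] from the centre of [k]. *)
have : points (Circle (c1, c2) rho0) (c1 + rho * u1, c2 + rho * u2).
  rewrite /points /dist2 /=.
  transitivity (rho ^+ 2 * (u1 ^+ 2 + u2 ^+ 2)); first by ring.
  by rewrite hu mulr1.
move=> /hsub; rewrite /disc /points /dist2 /= hc1 hc2 ht.
set L := _ + _; have -> : L = (r + rho + rho) ^+ 2.
  transitivity ((r + rho + rho) ^+ 2 * (u1 ^+ 2 + u2 ^+ 2)); first by rewrite /L; ring.
  by rewrite hu mulr1.
have p := mulr_gt0 r0 rho0; have p' := mulr_gt0 rho0 rho0.
by case; lra.
Qed.

Lemma tangent_lineE (R : realType) (l : set (R * R)) (c : circle R) :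
  tangent_line l c ->
  exists2 Q, unitv Q &
    l = [set x | (x.1 - (center c).1) * Q.1 + (x.2 - (center c).2) * Q.2
                 = radius c].
Proof.
case: c => [[c1 c2] rho rho0] [[a [b [e [ab ->]]]] [[x y] hp]] /=.
have [/= hl hc] : (line_eq a b e `&` points (Circle (c1, c2) rho0)) (x, y).
  by rewrite hp.
rewrite /line_eq /points /dist2 /= in hl hc.
have D0 : a ^+ 2 + b ^+ 2 != 0.
  apply: contra ab; rewrite paddr_eq0 ?sqr_ge0// !sqrf_eq0 => /andP[/eqP-> /eqP->].
  by [].
pose k := (a * (x - c1) + b * (y - c2)) / (a ^+ 2 + b ^+ 2).
have hk : k * (a ^+ 2 + b ^+ 2) = a * (x - c1) + b * (y - c2) by rewrite divfK.
clearbody k; have kk := congr1 ( *%R k) hk.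
(* The contact point is its own mirror image in the normal through the centre. *)
have : [set (x, y)] (2 * (c1 + k * a) - x, 2 * (c2 + k * b) - y).
  rewrite -hp; split; rewrite /line_eq /points /dist2 /=; first lra.
  move: hc hk kk; lra.
move=> [e1 e2].
have f1 : x - c1 = k * a by lra.
have f2 : y - c2 = k * b by lra.
have rho00 : rho != 0 by rewrite gt_eqF.
have k0 : k != 0.
  apply: contraNneq rho00 => k0; rewrite -sqrf_eq0 -hc f1 f2 k0; apply/eqP; ring.
exists ((x - c1) / rho, (y - c2) / rho).
  by rewrite /unitv /= !exprMn -mulrDl hc exprVn divff// expf_neq0.
have key z1 z2 :
    k * (a * (z1 - c1) + b * (z2 - c2)) - rho ^+ 2 = k * (a * z1 + b * z2 - e).
  rewrite -hc f1 f2 -hl -[in RHS](subrK c1 x) -[in RHS](subrK c2 y) f1 f2.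
  by ring.
have eq z1 z2 : (z1 - c1) * ((x - c1) / rho) + (z2 - c2) * ((y - c2) / rho)
    = k * (a * (z1 - c1) + b * (z2 - c2)) / rho by rewrite f1 f2; field.
apply/seteqP; split=> -[z1 z2] /=; rewrite /line_eq /= eq => hz.
  apply: (mulIf rho00); rewrite divfK// -expr2.
  by apply/eqP; rewrite -subr_eq0 key hz subrr mulr0.
apply/eqP; rewrite -subr_eq0 -(mulrI_eq0 _ (lregP k0)) -key subr_eq0 expr2.
by rewrite -{1}hz divfK.
Qed.

(** Seen from the two centres, the unit normals of [l] agree up to a sign [sg]; [sg = 1] gives the
    equation, and [sg = -1] would put the circles on opposite sides. *)
Lemma common_tangent_dot (R : realType) (l : set (R * R)) (c w : circle R)
    (Q : R * R) :
  unitv Q ->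
  l = [set x | (x.1 - (center w).1) * Q.1 + (x.2 - (center w).2) * Q.2
               = radius w] ->
  tangent_line l c -> same_side l c w ->
  ((center c).1 - (center w).1) * Q.1 + ((center c).2 - (center w).2) * Q.2
  = radius w - radius c.
Proof.
case: c w Q => [[c1 c2] rho rho0] [[d1 d2] r r0] [q1 q2] /=.
rewrite /unitv /= => hQ hl /tangent_lineE[[p1 p2]] /=.
rewrite /unitv /= => hP hl' [a [b [e [_ hab hsub]]]].
have inl z : l z <-> (z.1 - d1) * q1 + (z.2 - d2) * q2 = r by rewrite hl.
have inl' z : l z <-> (z.1 - c1) * p1 + (z.2 - c2) * p2 = rho by rewrite hl'.
have inab z : l z <-> a * z.1 + b * z.2 = e by rewrite hab.
have /inl'/= h1 : l (d1 + r * q1, d2 + r * q2).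
  apply/inl => /=; transitivity (r * (q1 ^+ 2 + q2 ^+ 2)); first by ring.
  by rewrite hQ mulr1.
have /inl'/= h2 : l (d1 + r * q1 - q2, d2 + r * q2 + q1).
  apply/inl => /=; transitivity (r * (q1 ^+ 2 + q2 ^+ 2)); first by ring.
  by rewrite hQ mulr1.
have h3 : q1 * p2 = q2 * p1 by lra.
pose sg := q1 * p1 + q2 * p2.
have e1 : p1 = sg * q1.
  rewrite -[LHS]mul1r -hQ /sg; move: (congr1 ( *%R q2) h3); lra.
have e2 : p2 = sg * q2.
  rewrite -[LHS]mul1r -hQ /sg; move: (congr1 ( *%R q1) h3); lra.
have h : sg * ((c1 - d1) * q1 + (c2 - d2) * q2 - r) = - rho.
  rewrite -h1 e1 e2 -[r in LHS]mulr1 -[in LHS]hQ; ring.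
clearbody sg.
have : sg ^+ 2 == 1.
  by rewrite -hP e1 e2 !exprMn -mulrDr hQ mulr1.
rewrite sqrf_eq1 => /orP[] /eqP sgE; rewrite sgE in h; first lra.
(* The points of the two circles farthest from [l] are joined by a segment that crosses [l] strictly
   between them. Both lie in the closed half-plane, so the one on [w] would lie on [l]. *)
exfalso.
have hY : e <= a * (c1 + rho * q1) + b * (c2 + rho * q2).
  apply: (hsub (c1 + rho * q1, c2 + rho * q2)); left.
  rewrite /points /dist2 /=.
  transitivity (rho ^+ 2 * (q1 ^+ 2 + q2 ^+ 2)); first by ring.
  by rewrite hQ mulr1.
have hX : e <= a * (d1 - r * q1) + b * (d2 - r * q2).
  apply: (hsub (d1 - r * q1, d2 - r * q2)); right.
  rewrite /points /dist2 /=.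
  transitivity (r ^+ 2 * (q1 ^+ 2 + q2 ^+ 2)); first by ring.
  by rewrite hQ mulr1.
have rr0 : r + rho != 0 by rewrite gt_eqF// addr_gt0.
pose s := r / (r + rho); have sE : s * (r + rho) = r by rewrite divfK.
have s0 : 0 <= s by rewrite divr_ge0 ?addr_ge0 ?ltW.
have s1 : 0 < 1 - s.
  by rewrite subr_gt0 ltr_pdivrMr ?addr_gt0// mul1r ltrDl.
clearbody s.
have /inab/= hZ : l ((1 - s) * (d1 - r * q1) + s * (c1 + rho * q1),
             (1 - s) * (d2 - r * q2) + s * (c2 + rho * q2)).
  apply/inl => /=.
  have hh : (c1 - d1) * q1 + (c2 - d2) * q2 = r + rho by lra.
  transitivity (s * ((c1 - d1) * q1 + (c2 - d2) * q2)
     + (s * (r + rho) - r) * (q1 ^+ 2 + q2 ^+ 2)); first by ring.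
  by rewrite hh sE subrr mul0r addr0.
have hXe : a * (d1 - r * q1) + b * (d2 - r * q2) = e.
  apply/eqP; rewrite eq_le hX andbT.
  rewrite -subr_le0 -(pmulr_rle0 _ s1).
  have := mulr_ge0 s0 (_ : 0 <= a * (c1 + rho * q1) + b * (c2 + rho * q2) - e).
  rewrite subr_ge0 => /(_ hY); move: hZ; lra.
have /inl/= : l (d1 - r * q1, d2 - r * q2) by apply/inab.
have : (d1 - r * q1 - d1) * q1 + (d2 - r * q2 - d2) * q2 = - r.
  transitivity (- r * (q1 ^+ 2 + q2 ^+ 2)); first by ring.
  by rewrite hQ mulr1.
lra.
Qed.

(** * Coordinates along the line of centres *)

Definition frame (R : realType) (e P : R * R) : R * R :=
  (e.1 * P.1 + e.2 * P.2, cross e P).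

Lemma frame_inj (R : realType) (e : R * R) : unitv e -> injective (frame e).
Proof.
case: e => e1 e2; rewrite /unitv /frame /cross /= => he [x y] [x' y'] /= [h1 h2].
congr (_, _); [rewrite -[x]mul1r -[x']mul1r | rewrite -[y]mul1r -[y']mul1r];
  rewrite -he.
- by move: (congr1 ( *%R e1) h1) (congr1 ( *%R e2) h2); lra.
- by move: (congr1 ( *%R e2) h1) (congr1 ( *%R e1) h2); lra.
Qed.

Lemma frame_unitv (R : realType) (e P : R * R) :
  unitv e -> unitv P -> unitv (frame e P).
Proof.
rewrite /unitv /frame /cross /= => he hP.
transitivity ((e.1 ^+ 2 + e.2 ^+ 2) * (P.1 ^+ 2 + P.2 ^+ 2)); first by ring.
by rewrite he hP mulr1.
Qed.

Lemma frame_dot (R : realType) (e P Q : R * R) : unitv e ->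
  (frame e P).1 * (frame e Q).1 + (frame e P).2 * (frame e Q).2
  = P.1 * Q.1 + P.2 * Q.2.
Proof.
rewrite /unitv /frame /cross /= => he.
transitivity ((e.1 ^+ 2 + e.2 ^+ 2) * (P.1 * Q.1 + P.2 * Q.2)); first by ring.
by rewrite he mul1r.
Qed.

Lemma polar_form (R : realType) (x : R * R) :
  exists d e, [/\ 0 <= d, unitv e & x = (d * e.1, d * e.2)].
Proof.
have [x0|x0] := eqVneq (x.1 ^+ 2 + x.2 ^+ 2) 0.
  (* For coinciding centres the direction is an arbitrary choice. *)
  exists 0, (1, 0); rewrite /unitv /= expr0n expr1n addr0 !mul0r; split=> //.
  move/eqP: x0; rewrite paddr_eq0 ?sqr_ge0// !sqrf_eq0 => /andP[/eqP h1 /eqP h2].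
  by rewrite [x]surjective_pairing h1 h2.
have h0 : 0 <= x.1 ^+ 2 + x.2 ^+ 2 by rewrite addr_ge0 ?sqr_ge0.
have d2 := sqr_sqrtr h0; set d := Num.sqrt _ in d2.
have d0 : d != 0 by rewrite -sqrf_eq0 d2.
exists d, (x.1 / d, x.2 / d); split; first exact: sqrtr_ge0.
  by rewrite /unitv /= !exprMn -mulrDl -d2 exprVn divff// expf_neq0.
by rewrite /= ![d * _]mulrC !divfK// -surjective_pairing.
Qed.

(* r, s: radii of w and k; d: distance of their centres *)
Definition apar (R : realType) (r s d : R) : R :=
  4 * r * (s + r) / ((s + r) ^+ 2 - d ^+ 2) - 1.

Definition bpar (R : realType) (r s d : R) : R :=
  4 * r * d / ((s + r) ^+ 2 - d ^+ 2).

Lemma par_annular (R : realType) (r s d : R) :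
  0 < r -> 0 <= d -> d + r < s -> annular (apar r s d) (bpar r s d).
Proof.
move=> r0 d0 hs; rewrite /annular /apar /bpar.
have h1 : 0 < s + r - d by lra.
have h2 : 0 < s + r + d by lra.
have -> : (s + r) ^+ 2 - d ^+ 2 = (s + r - d) * (s + r + d) by ring.
have n1 : s + r - d != 0 by rewrite gt_eqF.
have n2 : s + r + d != 0 by rewrite gt_eqF.
split.
- by apply: divr_ge0; apply: mulr_ge0 => //; lra.
- rewrite -subr_gt0.
  set L := (X in 0 < X).
  have -> : L = 2 * (s - r - d) / (s + r - d) by rewrite /L; field; rewrite n1 n2.
  by rewrite divr_gt0// mulr_gt0//; lra.
- rewrite -subr_gt0.
  set L := (X in 0 < X).
  have -> : L = 4 * r / (s + r + d) by rewrite /L; field; rewrite n1 n2.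
  by rewrite divr_gt0// mulr_gt0//; lra.
Qed.

(** The law of cosines is compared with internal tangency to [k]; the squares of [radius c] cancel,
    so the direction [P] determines the radius. *)
Lemma inscribed_radius (R : realType) (k w c : circle R) (d : R) (e P : R * R) :
  unitv e -> unitv P -> inscribed k w c ->
  (center k).1 = (center w).1 + d * e.1 ->
  (center k).2 = (center w).2 + d * e.2 ->
  center c = ((center w).1 + (radius w + radius c) * P.1,
              (center w).2 + (radius w + radius c) * P.2) ->
  (radius w + radius c) * (2 * (radius k + radius w) - 2 * d * (frame e P).1)
  = (radius k + radius w) ^+ 2 - d ^+ 2.
Proof.
move=> he hP [/tangent_internally_dist h _] k1 k2 hc; move: h.
rewrite /dist2 k1 k2 hc /frame /=; set r := radius w; set rho := radius c.
set x := _ ^+ 2 + _ => hx.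
have : x = (r + rho) ^+ 2 * (P.1 ^+ 2 + P.2 ^+ 2)
  - 2 * (r + rho) * d * (e.1 * P.1 + e.2 * P.2)
  + d ^+ 2 * (e.1 ^+ 2 + e.2 ^+ 2) by rewrite /x; ring.
by rewrite he hP hx; lra.
Qed.

(** Tangency to [l] gives [P.Q = 2 * r / (r + rho) - 1], where [r] and [rho] are the radii of [w]
    and [c]; [inscribed_radius] makes [1 / (r + rho)] affine in the first coordinate of
    [frame e P]. *)
Lemma inscribed_incident (R : realType) (k w c : circle R) (l : set (R * R))
    (d : R) (e P Q : R * R) :
  0 <= d -> d + radius w < radius k ->
  unitv e -> unitv P -> unitv Q -> inscribed k w c ->
  (center k).1 = (center w).1 + d * e.1 ->
  (center k).2 = (center w).2 + d * e.2 ->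
  center c = ((center w).1 + (radius w + radius c) * P.1,
              (center w).2 + (radius w + radius c) * P.2) ->
  l = [set x | (x.1 - (center w).1) * Q.1 + (x.2 - (center w).2) * Q.2
               = radius w] ->
  tangent_line l c -> same_side l c w ->
  incident (apar (radius w) (radius k) d) (bpar (radius w) (radius k) d)
    (frame e P) (frame e Q).
Proof.
move=> d0 hd he hP hQ ins k1 k2 hc hl tl ss.
have hr := inscribed_radius he hP ins k1 k2 hc.
have hdot := common_tangent_dot hQ hl tl ss.
split; [exact: frame_unitv|exact: frame_unitv|].
rewrite frame_dot//; move: hdot hr; rewrite hc; rewrite /frame /=.
have r0 := radius_gt0 w; have rho0 := radius_gt0 c.
move: (radius w) (radius c) (radius k) (e.1 * P.1 + e.2 * P.2) hd r0 rho0.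
move=> r rho s p hd r0 rho0 hPQ hr.
have n1 : s + r - d != 0 by rewrite gt_eqF//; lra.
have n2 : s + r + d != 0 by rewrite gt_eqF//; lra.
have D0 : (s + r) ^+ 2 - d ^+ 2 != 0.
  have -> : (s + r) ^+ 2 - d ^+ 2 = (s + r - d) * (s + r + d) by ring.
  by rewrite mulf_neq0.
have s0 : r + rho != 0 by rewrite gt_eqF// addr_gt0.
have hPQ' : P.1 * Q.1 + P.2 * Q.2 = 2 * r / (r + rho) - 1.
  apply: (mulfI s0); transitivity (r - rho); first by rewrite -hPQ; ring.
  by field.
have -> : apar r s d = 2 * r / (r + rho) - 1 + bpar r s d * p.
  rewrite /apar /bpar -hr; field.
  by move: D0; rewrite -hr mulf_eq0 negb_or => /andP[-> ->].
by rewrite hPQ'.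
Qed.

Lemma lies_inside_dist (R : realType) (k w : circle R) (d : R) (e : R * R) :
  lies_inside w k -> unitv e ->
  (center k).1 = (center w).1 + d * e.1 ->
  (center k).2 = (center w).2 + d * e.2 -> d + radius w < radius k.
Proof.
move=> hw he k1 k2.
(* The point of [w] opposite to the centre of [k], at distance [d + radius w] from it. *)
have /hw : points w ((center w).1 - radius w * e.1, (center w).2 - radius w * e.2).
  rewrite /points /dist2 /=.
  transitivity (radius w ^+ 2 * (e.1 ^+ 2 + e.2 ^+ 2)); first by ring.
  by rewrite he mulr1.
rewrite /disc /dist2 /= k1 k2; set L := _ + _.
have -> : L = (d + radius w) ^+ 2 * (e.1 ^+ 2 + e.2 ^+ 2) by rewrite /L; ring.
rewrite he mulr1 => h; rewrite ltNge; apply/negP => h'.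
have : radius k ^+ 2 <= (d + radius w) ^+ 2.
  by rewrite ler_sqr ?nnegrE// ?(le_trans _ h')// ltW// radius_gt0.
lra.
Qed.

Lemma mixed_chain_frame (R : realType) (k w : circle R) (d : R) (e : R * R)
    (c : nat -> circle R) (t : nat -> set (R * R)) :
  0 <= d -> d + radius w < radius k -> unitv e ->
  (center k).1 = (center w).1 + d * e.1 ->
  (center k).2 = (center w).2 + d * e.2 ->
  mixed_chain k w c t ->
  exists P Q, chain (apar (radius w) (radius k) d) (bpar (radius w) (radius k) d)
                P Q /\ forall i j, c i.+1 = c j.+1 <-> P i = P j.
Proof.
move=> d0 hd he k1 k2 [ins1 com1 step].
have ins i : inscribed k w (c i.+1).
  by case: i => [//|i]; have [[]] := step i.+1 isT.
have com i : common_external_tangent (t i.+1) (c i.+1) w.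
  by case: i => [//|i]; have [_ []] := step i.+1 isT.
have /choice[P hP] i : exists P, unitv P /\
    center (c i.+1) = ((center w).1 + (radius w + radius (c i.+1)) * P.1,
                       (center w).2 + (radius w + radius (c i.+1)) * P.2).
  by have [_ /tangent_externally_axis[P hP hc]] := ins i; exists P.
have /choice[Q hQ] i : exists Q, unitv Q /\
    t i.+1 = [set x | (x.1 - (center w).1) * Q.1 + (x.2 - (center w).2) * Q.2
                      = radius w].
  by have [_ /tangent_lineE[Q hQ hc] _] := com i; exists Q.
have eqP i j : c i.+1 = c j.+1 <-> P i = P j.
  have [hi ci] := hP i; have [hj cj] := hP j; split=> h.
    have r0 : radius w + radius (c j.+1) != 0 by rewrite gt_eqF// addr_gt0// radius_gt0.
    move: ci; rewrite h cj => -[/addrI/(mulfI r0) e1 /addrI/(mulfI r0) e2].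
    by rewrite [P i]surjective_pairing [P j]surjective_pairing e1 e2.
  have e1 := inscribed_radius he hi (ins i) k1 k2 ci.
  have e2 := inscribed_radius he hj (ins j) k1 k2 cj.
  (* Equal directions give equal radii, as the common factor in [inscribed_radius] is nonzero. *)
  have rr : radius (c i.+1) = radius (c j.+1).
    rewrite -h -e1 in e2; apply/esym/(addrI (radius w)).
    apply: mulIf e2.
    apply: contraTneq isT => z; move: e1; rewrite z mulr0.
    have w0 := radius_gt0 w.
    have : 0 < (radius k + radius w - d) * (radius k + radius w + d).
      by apply: mulr_gt0; lra.
    by move=> ? ?; exfalso; lra.
  by apply: circle_eq => //; rewrite ci cj rr h.
exists (frame e \o P), (frame e \o Q); split; last first.
  move=> i j /=; rewrite eqP; split=> [->//|]; exact: frame_inj.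
move=> i; have [hPi ci] := hP i; have [hPi1 ci1] := hP i.+1.
have [hQi ti] := hQ i; have [hQi1 ti1] := hQ i.+1.
have [[_ tl ss nc] [_ nt]] := step i.+1 isT.
have [tl0 _ ss0] := com i.
split=> /=.
- exact: (inscribed_incident d0 hd he hPi hQi (ins i) k1 k2 ci ti tl0 ss0).
- exact: (inscribed_incident d0 hd he hPi1 hQi (ins i.+1) k1 k2 ci1 ti tl ss).
- by move=> /(frame_inj he)/eqP.
- by move=> /(frame_inj he) eQ; apply: nt; rewrite ti ti1 eQ.
Qed.

Unset Implicit Arguments.

Theorem theorem3 (R : realType) (k w : circle R) (hw : lies_inside w k)
    (n : nat) (hn : (0 < n)%N) :
  (exists (c : nat -> circle R) (t : nat -> set (R * R)),
     mixed_chain k w c t /\ c n.+1 = c 1%N) ->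
  forall (c : nat -> circle R) (t : nat -> set (R * R)),
    mixed_chain k w c t -> c n.+1 = c 1%N.
Proof.
have [d [e [d0 he hk]]] :=
  polar_form ((center k).1 - (center w).1, (center k).2 - (center w).2).
have k1 : (center k).1 = (center w).1 + d * e.1.
  by case: hk => <- _; rewrite addrC subrK.
have k2 : (center k).2 = (center w).2 + d * e.2.
  by case: hk => _ <-; rewrite addrC subrK.
have hd := lies_inside_dist hw he k1 k2.
have hab := par_annular (radius_gt0 w) d0 hd.
move=> [c [t [ch closed]]] c' t' ch'.
have [P [Q [chP eP]]] := mixed_chain_frame d0 hd he k1 k2 ch.
have [P' [Q' [chP' eP']]] := mixed_chain_frame d0 hd he k1 k2 ch'.
(* [c i.+1] corresponds to [P i], so closure between indices [n.+1] and 1 is read between [n] and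
   0. *)
by apply/eP'; apply: (chain_closure hab chP chP'); apply/eP.
Qed.
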